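(* If $\mathcal N$ is a weak $T_{\mathrm{LinOrder}}$-on, then there exists a strong Borel $\mathcal E_2^*$-measurable $T_{\mathrm{LinOrder}}$-on $\mathcal N'$ such that $\lambda(\mathcal N\triangle\mathcal N')=0$.
   Context: $T_{\mathrm{LinOrder}}$ is the theory in the language with a single binary predicate $\prec$ and axioms $\neg(x\prec x)$; $x\ne y\to(x\prec y\equiv\neg(y\prec x))$; $(x\prec y\land y\prec z)\to x\prec z$ (strict linear orders); it is canonical. $\mathcal E_2=[0,1]^{r([2])}$, points written $(x_{\{1\}},x_{\{2\}},x_{\{1,2\}})$, with Lebesgue measure $\lambda$; more generally $\mathcal E_V=[0,1]^{r(V)}$ where $r(V)$ is the set of non-empty subsets of finite $V$, and for injective $\alpha:[k]\to V$, $\alpha^*(x)_A=x_{\alpha(A)}$. A $T_{\mathrm{LinOrder}}$-on is given by a single Lebesgue measurable set $\mathcal N\subseteq\mathcal E_2$. For a finite structure $M$ (a set $V(M)$ with a binary relation $R_M$), let $R(M)$ (resp. $\overline R(M)$) be the set of injections $\alpha:[2]\to V(M)$ with $(\alpha(1),\alpha(2))\in R_M$ (resp. $\notin$), $T_{\mathrm{ind}}(M,\mathcal N)=\bigcap_{\alpha\in R(M)}(\alpha^* )^{-1}(\mathcal N)\cap\bigcap_{\alpha\in\overline R(M)}(\alpha^* )^{-1}(\mathcal E_2\setminus\mathcal N)\subseteq\mathcal E_{V(M)}$. $\mathcal N$ is a weak $T_{\mathrm{LinOrder}}$-on if $\lambda(T_{\mathrm{ind}}(M,\mathcal N))=0$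 for every finite irreflexive structure $M$ that is not a strict linear order, and strong if $T_{\mathrm{ind}}(M,\mathcal N)\subseteq\mathcal D_{V(M)}=\{x:\exists i\ne j,\ x_{\{i\}}=x_{\{j\}}\}$ for every such $M$. $\mathcal N$ is Borel if it is a Borel set, and $\mathcal E_2^*$-measurable if for every $(x,y)\in[0,1]^2$ the section $\{z\in[0,1]:(x,y,z)\in\mathcal N\}$ is either $\emptyset$ or $[0,1]$. *)

(* Defs.v *)
From HB Require Import structures.
From mathcomp Require Import all_boot all_order all_algebra.
From mathcomp Require Import all_classical all_reals all_analysis.
From mathcomp Require Import measurable_realfun.

Set Implicit Arguments.
Unset Strict Implicit.
Unset Printing Implicit Defensive.
Import Order.TTheory GRing.Theory Num.Theory.
Import numFieldNormedType.Exports.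

Local Open Scope classical_set_scope.
Local Open Scope ring_scope.

Definition unit_interval (R : realType) : Type := {x : R | 0 <= x <= 1}.

Section unit_interval.
Context (R : realType).
Local Notation I01 := (unit_interval R).

HB.instance Definition _ := SubType.on I01.
HB.instance Definition _ := Choice.on I01.

Let zero_in01 : 0 <= (0 : R) <= 1. Proof. by rewrite lexx ler01. Qed.

HB.instance Definition _ := isPointed.Build I01 (exist _ 0 zero_in01).

Definition uval (x : I01) : R := \val x.

HB.instance Definition _ :=
  Measurable.copy I01 (g_sigma_algebra_preimageType uval).

Lemma image_uvalP (A : set I01) : measurable A -> measurable (uval @` A).
Proof.
move=> [B mB <-]; rewrite setTI.
have -> : uval @` (uval @^-1` B) = B `&` `[0, 1].
  apply/seteqP; split=> [_ [x Bx <-]|x [Bx]].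
    by split=> //=; rewrite in_itv/=; exact: valP x.
  by rewrite /= in_itv/= => x01; exists (exist _ x x01).
exact: measurableI.
Qed.

Definition lebesgue01 (A : set I01) : \bar R := lebesgue_measure (uval @` A).

Let lebesgue01_0 : lebesgue01 set0 = 0%E.
Proof. by rewrite /lebesgue01 image_set0 measure0. Qed.

Let lebesgue01_ge0 A : (0 <= lebesgue01 A)%E.
Proof. exact: measure_ge0. Qed.

Let lebesgue01_sigma_additive : semi_sigma_additive lebesgue01.
Proof.
move=> F mF tF mUF; rewrite /lebesgue01 image_bigcup.
apply: measure_semi_sigma_additive.
- by move=> n; exact: image_uvalP.
- apply/trivIsetP => i j _ _ ij.
  rewrite -subset0 => _ [[x Fix <-] [y Fjy /val_inj yx]]; move: Fjy.
  rewrite yx => Fjx; move/trivIsetP : tF => /(_ i j I I ij).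
  by rewrite -subset0 => /(_ x); exact.
- by rewrite -image_bigcup; exact: image_uvalP.
Qed.

HB.instance Definition _ := isMeasure.Build _ _ _ lebesgue01
  lebesgue01_0 lebesgue01_ge0 lebesgue01_sigma_additive.

Let lebesgue01_setT : lebesgue01 setT = 1%E.
Proof.
rewrite /lebesgue01 (_ : _ @` _ = `[0, 1]%classic).
  by rewrite lebesgue_measure_itv/= lte_fin ltr01 oppr0 adde0.
apply/seteqP; split=> [_ [x _ <-]|x /=]; rewrite ?in_itv/=.
  by rewrite in_itv/=; exact: valP x.
by move=> x01; exists (exist _ x x01).
Qed.

HB.instance Definition _ :=
  Measure_isProbability.Build _ _ _ lebesgue01 lebesgue01_setT.

End unit_interval.
Arguments lebesgue01 {R}.

Section tuple_power.
Context d (T : measurableType d) (R : realType) (P : probability T R).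

Definition cons_pair n (p : T * n.-tuple T) : n.+1.-tuple T :=
  [tuple of p.1 :: p.2].

Lemma measurable_cons_pair n : measurable_fun [set: _] (@cons_pair n).
Proof. exact: measurable_cons. Qed.

HB.instance Definition _ n :=
  isMeasurableFun.Build _ _ _ _ (@cons_pair n) (@measurable_cons_pair n).

Fixpoint tuple_power n : probability (n.-tuple T) R :=
  if n is m.+1 then distribution (P \x tuple_power m)%E (@cons_pair m)
  else dirac [tuple].

End tuple_power.

(* Generates the product sigma-algebra, which on a finite power of [0, 1] is the
   Borel sigma-algebra. *)
Definition cylinder d (T : measurableType d) (I : finType) : set (set (I -> T)) :=
  \bigcup_(i : I) preimage_set_system setT (@^~ i) measurable.

Section cube.
Context (R : realType) (I : finType).

Definition cube : Type := I -> unit_interval R.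

HB.instance Definition _ :=
  Measurable.copy cube (g_sigma_algebraType (@cylinder _ (unit_interval R) I)).

Definition cube_of_tuple (t : #|I|.-tuple (unit_interval R)) : cube :=
  fun i => tnth t (enum_rank i).

Lemma measurable_cube_of_tuple : measurable_fun [set: _] cube_of_tuple.
Proof.
apply: (@measurability _ _ _ cube _ _ (@cylinder _ (unit_interval R) I)) => //.
move=> _ [_ [i _ [B mB <-]] <-]; rewrite [X in _ @^-1` X]setTI.
exact: (measurable_tnth (enum_rank i)).
Qed.

HB.instance Definition _ :=
  isMeasurableFun.Build _ _ _ _ cube_of_tuple measurable_cube_of_tuple.

(* The product measure of #|I| copies of lebesgue01; it does not depend on the
   enumeration of I. *)
Definition cube_lebesgue : probability cube R :=
  distribution (tuple_power lebesgue01 #|I|) cube_of_tuple.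

End cube.

Definition nonempty_subset (V : finType) : Type :=
  {A : {set V} | A != finset.set0}.
HB.instance Definition _ V := Finite.on (nonempty_subset V).

Notation espace R V := (cube R (nonempty_subset V)).

Definition lambda {R : realType} {V : finType} : probability (espace R V) R :=
  cube_lebesgue R (nonempty_subset V).

(* The completed sigma-algebra: unions of a Borel set and a lambda-null set. *)
Definition lebesgue_measurable (R : realType) (V : finType)
    (A : set (espace R V)) : Prop :=
  completed_algebra_gen lambda A.

Section pullback.
Context (R : realType) (U V : finType) (alpha : U -> V).

Lemma imset_nonempty (A : nonempty_subset U) :
  imset alpha (mem (\val A)) != finset.set0.
Proof.
case: A => A /= /set0Pn[i iA]; apply/set0Pn.
by exists (alpha i); exact: imset_f.
Qed.

Definition pullback (x : espace R V) : espace R U :=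
  fun A => x (exist _ (imset alpha (mem (\val A))) (imset_nonempty A)).

End pullback.

Definition strict_linear_order (V : finType) (e : rel V) : Prop :=
  [/\ irreflexive e,
      (forall x y, x != y -> e x y = ~~ e y x) &
      transitive e].

(* [2] = {1, 2} is 'I_2: ord0 stands for 1 and ord_max for 2. *)
Definition edges (V : finType) (e : rel V) : set ('I_2 -> V) :=
  [set alpha | injective alpha /\ e (alpha ord0) (alpha ord_max)].

Definition nonedges (V : finType) (e : rel V) : set ('I_2 -> V) :=
  [set alpha | injective alpha /\ ~~ e (alpha ord0) (alpha ord_max)].

Definition Tind (R : realType) (V : finType) (e : rel V)
    (N : set (espace R 'I_2)) : set (espace R V) :=
  (\bigcap_(alpha in edges e) (pullback alpha @^-1` N)) `&`
  (\bigcap_(alpha in nonedges e) (pullback alpha @^-1` (~` N))).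

Lemma set1_nonempty (V : finType) (i : V) : finset.set1 i != finset.set0.
Proof. by apply/set0Pn; exists i; rewrite finset.inE. Qed.

Definition singleton (V : finType) (i : V) : nonempty_subset V :=
  exist _ (finset.set1 i) (set1_nonempty i).

Definition diagonal (R : realType) (V : finType) : set (espace R V) :=
  [set x | exists i j, i != j /\ x (singleton i) = x (singleton j)].

(* A set has Lebesgue measure 0 iff it is negligible for the Borel measure
   lambda. *)
Definition weak_linorder_on (R : realType) (N : set (espace R 'I_2)) : Prop :=
  lebesgue_measurable N /\
  forall (V : finType) (e : rel V),
    irreflexive e -> ~ strict_linear_order e -> lambda.-negligible (Tind e N).

Definition strong_linorder_on (R : realType) (N : set (espace R 'I_2)) : Prop :=
  lebesgue_measurable N /\
  forall (V : finType) (e : rel V),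
    irreflexive e -> ~ strict_linear_order e -> Tind e N `<=` @diagonal R V.

(* (x_{1}, x_{2}, x_{1,2}) = (x, y, z) *)
Definition point2 (R : realType) (x y z : unit_interval R) : espace R 'I_2 :=
  fun A => if A == singleton ord0 then x
           else if A == singleton ord_max then y
           else z.

Definition E2star_measurable (R : realType) (N : set (espace R 'I_2)) : Prop :=
  forall x y : unit_interval R,
    [set z | N (point2 x y z)] = set0 \/ [set z | N (point2 x y z)] = setT.

(* Main.v *)
Require Import Defs.
From HB Require Import structures.
From mathcomp Require Import all_boot all_order all_algebra.
From mathcomp Require Import all_classical all_reals all_analysis.
From mathcomp Require Import measurable_realfun.

(** Let mu be Lebesgue measure on [0, 1]. After changing N on a null set we may
    assume it is Borel; almost every point of E_V then induces a strict linear
    order on V. Let the rank of x be the measure of {(z, c) | (z, x, c) in N}.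
    For almost every (x, y, a) in N, transitivity says that for almost all
    (z, b, c), (z, x, b) in N implies (z, y, c) in N. Hence for almost every z
    either the section of N over (z, x) is null or that over (z, y) is full, so
    rank x <= rank y, and if the ranks are equal then the converse implication
    also holds almost everywhere. Almost surely, then, no vertex lies strictly
    between two vertices of equal rank; as some vertex of a triple lies between
    the two others, almost no triple has constant rank, so by Fubini almost no
    pair does. Therefore N coincides almost everywhere with rank x < rank y,
    and N' is the lexicographic order on (rank x, x). *)

Set Implicit Arguments.
Unset Strict Implicit.
Unset Printing Implicit Defensive.
Import Order.TTheory GRing.Theory Num.Theory.

Local Open Scope classical_set_scope.
Local Open Scope ring_scope.

(** * Fubini for almost-everywhere statements on a product of two spaces *)

Section ae_prod.
Context d1 d2 (T1 : measurableType d1) (T2 : measurableType d2) (R : realType).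
Variables (P : {measure set T1 -> \bar R}).
Variables (Q : {sigma_finite_measure set T2 -> \bar R}).

(** A measurable null set [B] covers the exceptions to [S]. The integral of the measures of its
    sections is 0, so almost every section is null. *)
Lemma ae_product_section (S : T1 * T2 -> Prop) :
  (\forall p \ae (P \x Q)%E, S p) ->
  \forall x \ae P, \forall y \ae Q, S (x, y).
Proof.
move=> [B [mB PQB SB]].
have mphi := measurable_fun_xsection Q mB.
have : (\int[P]_(x in setT) `|(Q \o xsection B) x| = 0)%E.
  rewrite -PQB /=; apply: eq_integral => x _.
  by rewrite gee0_abs// measure_ge0.
move/(ae_eq_integral_abs P measurableT mphi).
apply: filterS => x /(_ I) /= QB; exists (xsection B x); split => //.
  exact: measurable_xsection.
by move=> y /= Sxy; rewrite /xsection/= inE; exact: SB.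
Qed.

(** Measurability of [S] lets the measure of its complement be computed as the integral of section
    measures, which vanish almost everywhere. *)
Lemma ae_section_product (S : set (T1 * T2)) : measurable S ->
  (\forall x \ae P, \forall y \ae Q, S (x, y)) ->
  \forall p \ae (P \x Q)%E, S p.
Proof.
move=> mS aeS.
have mB := measurableC mS.
have mphi := measurable_fun_xsection Q mB.
exists (~` S); split => //.
have /(ae_eq_integral_abs P measurableT mphi) <- :
    ae_eq P setT (Q \o xsection (~` S)) (cst 0%E).
  apply: filterS aeS => x /= [C [mC QC SC]] _.
  apply/eqP; rewrite -measure_le0 -QC le_measure ?inE//.
    exact: measurable_xsection.
  by move=> y; rewrite /xsection/= inE => ?; exact: SC.
by apply: eq_integral => x _; rewrite gee0_abs// measure_ge0.
Qed.

End ae_prod.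

(** * Iterated almost-everywhere quantifiers over finite powers *)

Section ae_tuple.
Context d (T : measurableType d) (R : realType) (P : probability T R).

(** Choosing the coordinates one at a time, head first, allows an argument to be made between two
    choices. *)
Fixpoint iterated_ae n : (n.-tuple T -> Prop) -> Prop :=
  if n is m.+1 then
    fun S => \forall x \ae P, iterated_ae (fun t : m.-tuple T => S [tuple of x :: t])
  else fun S => S [tuple].

Lemma ae_iterated n (S : n.-tuple T -> Prop) :
  (\forall t \ae tuple_power P n, S t) -> iterated_ae S.
Proof.
elim: n S => [S [B [mB]]|n IH S [B [mB B0 SB]]] /=.
  rewrite diracE; have [|/negP nB _ SB] := boolP (_ \in _).
    by move=> _ /eqP; rewrite onee_eq0.
  by apply: contrapT => /SB Bt; apply: nB; rewrite inE.
have : \forall p \ae (P \x tuple_power P n)%E, S (cons_pair p).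
  exists (@cons_pair _ T n @^-1` B); split => //.
    by rewrite -[X in measurable X]setTI; exact: measurable_cons_pair.
  by move=> p /= Sp; exact: SB.
by move/ae_product_section; apply: filterS => x; exact: IH.
Qed.

Lemma iterated_ae_measurable n (S : set (n.-tuple T)) : measurable S ->
  iterated_ae S -> \forall t \ae tuple_power P n, S t.
Proof.
elim: n S => [S mS St|n IH S mS] /=.
  exists (~` S); split => //; first exact: measurableC.
  by rewrite /= diracE memNset//=; exact.
move=> aeS.
have mS' : measurable (@cons_pair _ T n @^-1` S).
  by rewrite -[X in measurable X]setTI; exact: measurable_cons_pair.
have : \forall p \ae (P \x tuple_power P n)%E, (@cons_pair _ T n @^-1` S) p.
  apply: ae_section_product => //.
  apply: filterS aeS => x /= aex; apply: IH => //.
  rewrite (_ : (fun t => _) = xsection (@cons_pair _ T n @^-1` S) x); last first.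
    by apply/seteqP; split=> t; rewrite /xsection/= inE.
  exact: measurable_xsection.
move=> /(measure_negligible (measurableC mS')) S0.
by exists (~` S); split => //; exact: measurableC.
Qed.

Lemma tuple_power_box n (B : 'I_n -> set T) : (forall j, measurable (B j)) ->
  tuple_power P n [set t | forall j, B j (tnth t j)] = (\prod_j P (B j))%E.
Proof.
elim: n B => [B mB|n IH B mB].
  by rewrite /= big_ord0 diracE mem_set// => -[].
rewrite big_ord_recl /= -IH// -product_measure1E//.
  congr (product_measure1 _ _ _); apply/seteqP; split => -[x t] /=.
    move=> Bxt; split; first exact: (Bxt ord0).
    by move=> j; have := Bxt (lift ord0 j); rewrite tnthS.
  move=> [Bx Bt] j; case: (unliftP ord0 j) => [k ->|->//].
  by rewrite tnthS.
rewrite (_ : [set t | _] =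
    \bigcap_(j in setT) (fun t => tnth t j) @^-1` (B (lift ord0 j))).
  apply: fin_bigcap_measurable => // j _.
  by rewrite -[X in measurable X]setTI; exact: measurable_tnth.
by apply/seteqP; split=> t /=; [move=> h j _; exact: h | move=> h j; exact: h].
Qed.

End ae_tuple.

(** * Product measure on cubes and its invariance under coordinate selection *)

Section cube_theory.
Context (R : realType).
Local Notation I01 := (unit_interval R).
Local Notation mu := (@lebesgue01 R).

Lemma measurable_coordinate (I : finType) (i : I) :
  measurable_fun [set: cube R I] (fun x => x i).
Proof.
move=> _ B mB; rewrite setTI; apply: sub_sigma_algebra.
by exists i => //; exists B => //; rewrite setTI.
Qed.

Lemma measurable_into_cube d (T : measurableType d) (I : finType)
    (f : T -> cube R I) :
  (forall i, measurable_fun [set: T] (fun t => f t i)) ->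
  measurable_fun [set: T] f.
Proof.
move=> mf.
apply: (@measurability _ _ _ (cube R I) _ _ (@cylinder _ I01 I)) => //.
move=> _ [_ [i _ [B mB <-]] <-]; rewrite [X in _ @^-1` X]setTI.
exact: mf.
Qed.

Definition box (I : finType) (B : I -> set I01) : set (cube R I) :=
  [set x | forall i, B i (x i)].

Definition boxes (I : finType) : set (set (cube R I)) :=
  [set box B | B in [set B | forall i, measurable (B i)]].

Lemma boxes_generate (I : finType) : @measurable _ (cube R I) = <<s @boxes I >>.
Proof.
apply/seteqP; split.
  apply: smallest_sub; first exact: smallest_sigma_algebra.
  move=> _ [i _ [B mB <-]]; apply: sub_sigma_algebra.
  exists (fun j => if j == i then B else setT).
    by move=> j /=; case: ifP.
  rewrite setTI; apply/seteqP; split=> x /=.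
    by move/(_ i); rewrite eqxx.
  by move=> Bx j; case: eqP => // ->.
apply: smallest_sub; first exact: sigma_algebra_measurable.
move=> _ [B mB <-].
rewrite (_ : box B = \bigcap_(i in setT) (fun x : cube R I => x i) @^-1` B i).
  apply: fin_bigcap_measurable => // i _.
  by rewrite -[X in measurable X]setTI; exact: measurable_coordinate.
by apply/seteqP; split=> x /=; [move=> h i _; exact: h | move=> h i; exact: h].
Qed.

Lemma boxes_setI (I : finType) : setI_closed (@boxes I).
Proof.
move=> _ _ [B mB <-] [C mC <-]; exists (fun i => B i `&` C i).
  by move=> i; exact: measurableI.
apply/seteqP; split=> x /= => [h|[hB hC] i]; last by split; [exact: hB|exact: hC].
by split=> i; have [] := h i.
Qed.

Section select.
Context (I : finType) (n : nat) (s : I -> 'I_n).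

Definition select (t : n.-tuple I01) : cube R I := fun i => tnth t (s i).

Lemma measurable_select : measurable_fun [set: _] select.
Proof. by apply: measurable_into_cube => i; exact: measurable_tnth. Qed.

HB.instance Definition _ :=
  isMeasurableFun.Build _ _ _ _ select measurable_select.

Hypothesis s_inj : injective s.

Lemma tuple_power_select_box (B : I -> set I01) :
  (forall i, measurable (B i)) ->
  tuple_power mu n (select @^-1` box B) = (\prod_i mu (B i))%E.
Proof.
move=> mB.
(* For [j] outside the image of [s] the condition is vacuous, so [B' j] is the whole interval and
   contributes a factor 1. *)
pose B' j := [set x : I01 | forall i, s i = j -> B i x].
have B's i : B' (s i) = B i.
  by apply/seteqP; split=> x /=; [exact | move=> Bx k /s_inj ->].
have B'T j : (forall i, s i != j) -> B' j = setT.
  by move=> sj; apply/seteqP; split=> // x _ i sij; have := sj i; rewrite sij eqxx.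
rewrite (_ : _ @^-1` _ = [set t | forall j, B' j (tnth t j)]); last first.
  apply/seteqP; split=> t /=.
    by move=> h j i <-; exact: h.
  by move=> h i; exact: h.
rewrite tuple_power_box; last first.
  move=> j; have [[i <-]|ni] := pselect (exists i, s i = j); first by rewrite B's.
  by rewrite B'T// => i; apply/eqP => sij; apply: ni; exists i.
rewrite [RHS](partition_big s xpredT)//=; apply: eq_bigr => j _.
have [[i <-]|ni] := pselect (exists i, s i = j).
  rewrite B's (big_pred1 i)// => k /=; apply/eqP/eqP => [/s_inj//|->//].
have nj i : s i != j by apply/eqP => sij; apply: ni; exists i.
by rewrite B'T// big_pred0 ?probability_setT// => i; exact/negbTE.
Qed.

End select.

(** Both sides are finite measures that agree on boxes, an intersection-stable generating family.
    With [n] larger than the size of [I] this also computes marginals. *)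
Lemma cube_lebesgue_select (I : finType) n (s : I -> 'I_n) (A : set (cube R I)) :
  injective s -> measurable A ->
  cube_lebesgue R I A = tuple_power mu n (select s @^-1` A).
Proof.
move=> s_inj mA.
pose m2 := distribution (tuple_power mu n) (select s).
apply: (@measure_unique _ _ _ (@boxes I) (fun=> setT) _ _ _ _
  (cube_lebesgue R I) m2) => //.
- exact: boxes_generate.
- exact: boxes_setI.
- by move=> _; exists (fun=> setT) => //; apply/seteqP; split.
- by apply/seteqP; split=> // x _; exists 0%N.
- move=> _ [B mB <-].
  rewrite -[LHS]/(tuple_power mu #|I| (select enum_rank @^-1` box B)).
  rewrite -[RHS]/(tuple_power mu n (select s @^-1` box B)).
  by rewrite !tuple_power_select_box//; exact: enum_rank_inj.
- by move=> _; rewrite [X in (X < _)%E](probability_setT (cube_lebesgue R I)) ltry.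
Qed.

Lemma ae_select (I : finType) n (s : I -> 'I_n) (S : set (cube R I)) :
  injective s ->
  (\forall x \ae cube_lebesgue R I, S x) ->
  \forall t \ae tuple_power mu n, S (select s t).
Proof.
move=> s_inj [B [mB B0 SB]]; exists (select s @^-1` B); split.
- by rewrite -[X in measurable X]setTI; exact: measurable_select.
- by rewrite -B0 (cube_lebesgue_select s_inj).
- by move=> t St; exact: SB.
Qed.

Lemma select_ae (I : finType) n (s : I -> 'I_n) (S : set (cube R I)) :
  injective s -> measurable S ->
  (\forall t \ae tuple_power mu n, S (select s t)) ->
  \forall x \ae cube_lebesgue R I, S x.
Proof.
move=> s_inj mS aeS; exists (~` S); split => //; first exact: measurableC.
rewrite (cube_lebesgue_select s_inj); last exact: measurableC.
apply: measure_negligible => //.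
rewrite -[X in measurable X]setTI; apply: measurable_select => //.
exact: measurableC.
Qed.

Lemma measurable_pullback (U V : finType) (alpha : U -> V) :
  measurable_fun [set: espace R V] (pullback alpha : espace R V -> espace R U).
Proof. by apply: measurable_into_cube => A; exact: measurable_coordinate. Qed.

(** An injection sends distinct subsets to distinct images, so [pullback alpha] selects distinct
    coordinates and preserves [lambda]. *)
Lemma ae_pullback (U V : finType) (alpha : U -> V) (S : set (espace R U)) :
  injective alpha ->
  (\forall x \ae lambda, S x) ->
  \forall x \ae (lambda : probability (espace R V) R), S (pullback alpha x).
Proof.
move=> alpha_inj [B [mB B0 SB]]; exists (pullback alpha @^-1` B); split.
- by rewrite -[X in measurable X]setTI; exact: measurable_pullback.
- pose s (A : nonempty_subset U) : 'I_#|{: nonempty_subset V}| :=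
    enum_rank (exist (fun C : {set V} => C != finset.set0) _ (imset_nonempty alpha A)
      : nonempty_subset V).
  have s_inj : injective s.
    move=> A A' /enum_rank_inj /(congr1 val) /= /(imset_inj alpha_inj).
    by move=> AA'; apply: val_inj; exact: AA'.
  rewrite -[LHS]/(tuple_power mu _ (select s @^-1` B)).
  by rewrite -(cube_lebesgue_select s_inj).
- by move=> x Sx; exact: SB.
Qed.

End cube_theory.

(** * Ordered pairs of vertices and the three coordinates of an edge *)

Definition pair_map (V : Type) (i j : V) : 'I_2 -> V :=
  fun k => if k == ord0 then i else j.

Lemma ord2_max (k : 'I_2) : k != ord0 -> k = ord_max.
Proof. by case: k => -[|[|k]] // kP _; exact: val_inj. Qed.

Lemma pair_map_inj (V : eqType) (i j : V) : i != j -> injective (pair_map i j).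
Proof.
move=> ij k l; rewrite /pair_map.
case: (eqVneq k ord0) => [->|/ord2_max ->];
  case: (eqVneq l ord0) => [->|/ord2_max ->] //.
  by move=> /eqP; rewrite (negbTE ij).
by move=> /esym/eqP; rewrite (negbTE ij).
Qed.

Lemma pair_mapE (V : Type) (alpha : 'I_2 -> V) :
  alpha = pair_map (alpha ord0) (alpha ord_max).
Proof.
by apply/funext => k; rewrite /pair_map; case: eqVneq => [->|/ord2_max ->].
Qed.

Lemma set2_nonempty (V : finType) (i j : V) :
  finset.setU [set i]%SET [set j]%SET != finset.set0.
Proof. by apply/set0Pn; exists i; rewrite !finset.inE eqxx. Qed.

Definition doubleton (V : finType) (i j : V) : nonempty_subset V :=
  exist (fun A : {set V} => A != finset.set0) _ (set2_nonempty i j).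

Section pullback_pair.
Context (R : realType) (V : finType).

Lemma pullback_singleton (U : finType) (alpha : U -> V) (x : espace R V) k :
  pullback alpha x (singleton k) = x (singleton (alpha k)).
Proof. by congr x; apply: val_inj; rewrite /= imset_set1. Qed.

Lemma nonempty_ord2 (A : nonempty_subset 'I_2) :
  [\/ A = singleton ord0, A = singleton ord_max | A = doubleton ord0 ord_max].
Proof.
case: A => A A0.
have AE (B : {set 'I_2}) : (ord0 \in A) = (ord0 \in B) ->
    (ord_max \in A) = (ord_max \in B) -> A = B.
  by move=> e0 e1; apply/setP => k; case: (eqVneq k ord0) => [->|/ord2_max ->].
case a0 : (ord0 \in A); case a1 : (ord_max \in A).
- by apply: Or33; apply: val_inj; apply: AE; rewrite ?a0 ?a1 !finset.inE.
- by apply: Or31; apply: val_inj; apply: AE; rewrite ?a0 ?a1 !finset.inE.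
- by apply: Or32; apply: val_inj; apply: AE; rewrite ?a0 ?a1 !finset.inE.
- by case/negP: A0; apply/eqP/AE; rewrite ?a0 ?a1 finset.inE.
Qed.

Lemma singleton_inj (W : finType) : injective (@singleton W).
Proof. by move=> i j [/set1_inj]. Qed.

Lemma doubleton_neq (W : finType) (i j k : W) : i != j -> doubleton i j != singleton k.
Proof.
move=> ij; apply/eqP => -[] /(congr1 (fun A : {set W} => #|A|)).
by rewrite cards1 cards2 ij.
Qed.

Lemma point2_0 (x y z : unit_interval R) : point2 x y z (singleton ord0) = x.
Proof. by rewrite /point2 eqxx. Qed.

Lemma point2_1 (x y z : unit_interval R) : point2 x y z (singleton ord_max) = y.
Proof. by rewrite /point2 eqxx (inj_eq (@singleton_inj _)). Qed.

Lemma point2_2 (x y z : unit_interval R) : point2 x y z (doubleton ord0 ord_max) = z.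
Proof. by rewrite /point2 !(negbTE (doubleton_neq _ _)). Qed.

Lemma espace2_eq (x y : espace R 'I_2) :
  x (singleton ord0) = y (singleton ord0) ->
  x (singleton ord_max) = y (singleton ord_max) ->
  x (doubleton ord0 ord_max) = y (doubleton ord0 ord_max) -> x = y.
Proof. by move=> e0 e1 e2; apply/funext => A; case: (nonempty_ord2 A) => ->. Qed.

Lemma pullback_pair (i j : V) (x : espace R V) :
  pullback (pair_map i j) x =
  point2 (x (singleton i)) (x (singleton j)) (x (doubleton i j)).
Proof.
apply: espace2_eq; rewrite ?pullback_singleton ?point2_0 ?point2_1 ?point2_2 //.
congr x; apply: val_inj => /=.
by rewrite imsetU1 imset_set1.
Qed.

End pullback_pair.

(** * The relation induced by a point, and its almost sure linearity *)

Section induced.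
Context (R : realType).
Implicit Types N : set (espace R 'I_2).

Definition induced_rel N (V : finType) (x : espace R V) : rel V :=
  fun i j => (i != j) && `[< N (pullback (pair_map i j) x) >].

Lemma Tind_induced_rel N (V : finType) (x : espace R V) (e : rel V) :
  e =2 induced_rel N x -> Tind e N x.
Proof.
move=> eE; split=> alpha [alpha_inj]; rewrite eE /induced_rel -pair_mapE /=.
  by move=> /andP[_ /asboolP].
by rewrite (inj_eq alpha_inj) /= => /asboolP.
Qed.

Lemma induced_rel_Tind N (V : finType) (x : espace R V) (e : rel V) :
  irreflexive e -> Tind e N x -> e =2 induced_rel N x.
Proof.
move=> e_irr [xe xne] i j; rewrite /induced_rel.
have [->|ij /=] := eqVneq i j; first by rewrite e_irr.
have := pair_map_inj ij; case eij : (e i j) => pij.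
  by apply/esym/asboolP; apply: xe; split.
by apply/esym/asboolP; apply: xne; split => //; exact/negbT.
Qed.

Lemma strict_linear_order_eq2 (V : finType) (e e' : rel V) :
  e =2 e' -> strict_linear_order e -> strict_linear_order e'.
Proof.
move=> ee' [irr asym tr]; split.
- by move=> i; rewrite -ee' irr.
- by move=> i j ij; rewrite -!ee' asym.
- by move=> j i k; rewrite -!ee'; exact: tr.
Qed.

(** There are only finitely many relations on [V], so the null sets attached to the non-linear ones
    have a null union. *)
Lemma weak_ae_linear N (V : finType) : weak_linorder_on N ->
  \forall x \ae (lambda : probability (espace R V) R),
    strict_linear_order (induced_rel N x).
Proof.
move=> [_ weakN].
(* Coding relations as finite functions makes the quantifier over them finite. *)
pose er (g : {ffun V * V -> bool}) : rel V := fun i j => g (i, j).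
have : \forall x \ae (lambda : probability (espace R V) R),
    forall g : {ffun V * V -> bool}, irreflexive (er g) ->
      ~ strict_linear_order (er g) -> ~ Tind (er g) N x.
  apply: filter_forall => g.
  have [girr|ngirr] := pselect (irreflexive (er g)); last by apply: aeW => x.
  have [glin|nglin] := pselect (strict_linear_order (er g)); first by apply: aeW => x.
  apply: negligibleS (weakN V (er g) girr nglin) => x /= nx.
  by apply: contrapT => nT; apply: nx.
apply: filterS => x nT.
pose g := [ffun p : V * V => induced_rel N x p.1 p.2].
have gE : er g =2 induced_rel N x by move=> i j; rewrite /er ffunE.
apply: contrapT => nlin; apply: (nT g).
- by move=> i; rewrite gE /induced_rel eqxx.
- by move/(strict_linear_order_eq2 gE).
- exact: Tind_induced_rel.
Qed.

(** Outside finitely many null sets, one for each pair of distinct vertices, [N] and [N0] induce the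
    same relation. *)
Lemma weak_ae_congr N N0 (V : finType) : weak_linorder_on N ->
  lambda.-negligible (N `+` N0) ->
  \forall x \ae (lambda : probability (espace R V) R),
    strict_linear_order (induced_rel N0 x).
Proof.
move=> weakN NN0.
have NN0' : \forall p \ae (lambda : probability (espace R 'I_2) R), N p <-> N0 p.
  apply: negligibleS NN0 => p /= nNN0; apply: contrapT => nY; apply: nNN0.
  split=> Np; apply: contrapT => nNp; apply: nY; [by left|by right].
have : \forall x \ae (lambda : probability (espace R V) R),
    forall ij : V * V, ij.1 != ij.2 ->
      N (pullback (pair_map ij.1 ij.2) x) <-> N0 (pullback (pair_map ij.1 ij.2) x).
  apply: filter_forall => -[i j] /=.
  have [->|ij] := eqVneq i j; first by apply: aeW.
  by apply: filterS (ae_pullback (pair_map_inj ij) NN0').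
apply: filterS2 (weak_ae_linear V weakN) => x lin NN0x.
apply: strict_linear_order_eq2 lin => i j; rewrite /induced_rel.
by have [//|ij /=] := eqVneq i j; apply: asbool_equiv_eq; exact: (NN0x (i, j)).
Qed.

End induced.

(** * Enumerating the coordinates of edges and triples *)

Definition o0 : 'I_3 := ord0.
Definition o1 : 'I_3 := @Ordinal 3 1 isT.
Definition o2 : 'I_3 := ord_max.

Definition index2 (A : nonempty_subset 'I_2) : 'I_3 :=
  if A == singleton ord0 then o0 else if A == singleton ord_max then o1 else o2.

(* The pair {0, 1} comes before the vertex 2, so that iterated quantifiers over
   a triple begin with the edge spanned by its first two vertices. *)
Definition index3 (A : nonempty_subset 'I_3) : 'I_7 :=
  inord (match o0 \in val A, o1 \in val A, o2 \in val A with
  | true, false, false => 0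
  | false, true, false => 1
  | true, true, false => 2
  | false, false, true => 3
  | true, false, true => 4
  | false, true, true => 5
  | _, _, _ => 6
  end).

Lemma ord3E (k : 'I_3) : [\/ k = o0, k = o1 | k = o2].
Proof.
case: k => -[|[|[|k]]] // kP; [apply: Or31|apply: Or32|apply: Or33]; exact: val_inj.
Qed.

Lemma index2_inj : injective index2.
Proof.
move=> A B; rewrite /index2.
have s : singleton ord_max != singleton ord0 :> nonempty_subset 'I_2.
  by rewrite (inj_eq (@singleton_inj _)).
have d0 : doubleton ord0 ord_max != singleton ord0 :> nonempty_subset 'I_2
  by exact: doubleton_neq.
have d1 : doubleton ord0 ord_max != singleton ord_max :> nonempty_subset 'I_2
  by exact: doubleton_neq.
case: (nonempty_ord2 A) => ->; case: (nonempty_ord2 B) => ->;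
  by rewrite ?eqxx ?(negbTE s) ?(negbTE d0) ?(negbTE d1).
Qed.

Lemma index3_inj : injective index3.
Proof.
move=> [A A0] [B B0] /(congr1 val); rewrite /index3 /=.
have ext (C D : {set 'I_3}) : (o0 \in C) = (o0 \in D) ->
    (o1 \in C) = (o1 \in D) -> (o2 \in C) = (o2 \in D) -> C = D.
  by move=> e0 e1 e2; apply/setP => k; case: (ord3E k) => ->.
(* The default index 6 belongs to the full set; the empty set, which would share it, has to be ruled
   out. *)
have nz (C : {set 'I_3}) : C != finset.set0 ->
    (o0 \in C) = false -> (o1 \in C) = false -> (o2 \in C) = false -> False.
  by move=> /eqP C0 e0 e1 e2; apply/C0/ext; rewrite finset.inE.
move=> AB; apply: val_inj; move: AB => /=.
move: (nz A A0) (nz B B0) (ext A B).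
case: (o0 \in A); case: (o1 \in A); case: (o2 \in A);
case: (o0 \in B); case: (o1 \in B); case: (o2 \in B);
rewrite !inordK // => nA nB eqAB _; try exact: eqAB; by [case: nA|case: nB].
Qed.

Section iterated_ae_points.
Context (R : realType).
Local Notation I01 := (unit_interval R).
Local Notation mu := (@lebesgue01 R).

Definition triple (x y a z b c d : I01) : espace R 'I_3 :=
  select index3 [tuple x; y; a; z; b; c; d].

Lemma tripleE x y a z b c d :
  let t := triple x y a z b c d in
  ((t (singleton o0) = x) * (t (singleton o1) = y) * (t (singleton o2) = z) *
  (t (doubleton o0 o1) = a) * (t (doubleton o2 o0) = b) *
  (t (doubleton o2 o1) = c))%type.
Proof.
by do !split; rewrite /triple /select (tnth_nth x) /index3 /= !finset.inE /= inordK.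
Qed.

Lemma ae_triple (S : set (espace R 'I_3)) :
  (\forall t \ae lambda, S t) ->
  \forall x \ae mu, \forall y \ae mu, \forall a \ae mu, \forall z \ae mu,
  \forall b \ae mu, \forall c \ae mu, \forall d \ae mu,
    S (triple x y a z b c d).
Proof. by move=> /(ae_select index3_inj) /ae_iterated. Qed.

Lemma triple_ae (S : set (espace R 'I_3)) : measurable S ->
  (\forall x \ae mu, \forall y \ae mu, \forall a \ae mu, \forall z \ae mu,
   \forall b \ae mu, \forall c \ae mu, \forall d \ae mu,
    S (triple x y a z b c d)) ->
  \forall t \ae lambda, S t.
Proof.
move=> mS aeS; apply: (select_ae index3_inj mS).
apply: iterated_ae_measurable; last exact: aeS.
by rewrite -[X in measurable X]setTI; exact: measurable_select.
Qed.

Lemma point2_ae (S : set (espace R 'I_2)) : measurable S ->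
  (\forall x \ae mu, \forall y \ae mu, \forall a \ae mu, S (point2 x y a)) ->
  \forall p \ae lambda, S p.
Proof.
move=> mS aeS; apply: (select_ae index2_inj mS).
apply: iterated_ae_measurable.
  by rewrite -[X in measurable X]setTI; exact: measurable_select.
apply: filterS aeS => x; apply: filterS => y; apply: filterS => a /=.
rewrite (_ : select index2 _ = point2 x y a)//.
apply/funext => A; rewrite /select /index2 /point2.
case: ifP => _; last case: ifP => _; by rewrite (tnth_nth x).
Qed.

Lemma measurable_point2 d (T : measurableType d) (f g h : T -> I01) :
  measurable_fun setT f -> measurable_fun setT g -> measurable_fun setT h ->
  measurable_fun setT (fun t => point2 (f t) (g t) (h t)).
Proof.
move=> mf mg mh; apply: measurable_into_cube => A; rewrite /point2.
by case: (A == singleton ord0) => //; case: (A == singleton ord_max).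
Qed.

End iterated_ae_points.

(** * Independent variables, and inclusion up to a null set *)

Section ae_logic.
Context d (T : measurableType d) (R : realType) (P : {measure set T -> \bar R}).

Lemma ae_implyP (A B : T -> Prop) :
  (\forall b \ae P, \forall c \ae P, A b -> B c) ->
  (\forall b \ae P, ~ A b) \/ (\forall c \ae P, B c).
Proof.
move=> AB; have [|nB] := pselect (\forall c \ae P, B c); [by right|left].
apply: filterS AB => b AB Ab; apply: nB.
by apply: filterS AB => c; exact.
Qed.

End ae_logic.

(** Serves to discard quantifiers over coordinates that a statement does not mention. *)
Lemma ae_const d (T : measurableType d) (R : realType) (P : probability T R)
    (Q : Prop) : (\forall x \ae P, Q) -> Q.
Proof.
move=> aeQ; apply: contrapT => nQ.
have /(measure_negligible measurableT) : P.-negligible setT.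
  by apply: negligibleS aeQ => x _.
move=> P0; have := probability_setT P; rewrite [LHS]P0 => /esym/eqP.
by rewrite onee_eq0.
Qed.

Section measure_almost_subset.
Context d (T : measurableType d) (R : realType) (m : {measure set T -> \bar R}).
Variables (A B : set T).
Hypotheses (mA : measurable A) (mB : measurable B) (AB : m (A `\` B) = 0%E).

Let mAI : m A = m (A `&` B).
Proof.
transitivity (m (A `\` B) + m (A `&` B))%E; first exact: measureDI.
by rewrite AB add0e.
Qed.

Lemma almost_subset_le : (m A <= m B)%E.
Proof. by rewrite mAI le_measure ?inE//; exact: measurableI. Qed.

Lemma almost_subset_eq : (m B < +oo)%E -> m A = m B -> m (B `\` A) = 0%E.
Proof.
move=> Boo eAB; transitivity (m B - m (A `&` B))%E.
  by rewrite [A `&` B]setIC; exact: measureD.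
by rewrite -mAI eAB subee// ge0_fin_numE.
Qed.

End measure_almost_subset.

(** * The rank of a vertex, and why ranks are almost surely distinct *)

Section rank.
Context (R : realType) (N : set (espace R 'I_2)).
Local Notation I01 := (unit_interval R).
Local Notation mu := (@lebesgue01 R).
Hypothesis mN : measurable N.
Hypothesis linN : forall V : finType,
  \forall x \ae (lambda : probability (espace R V) R),
    strict_linear_order (induced_rel N x).

(** The upper vertex comes first, so that [xsection below x] consists of the [(z, b)] placing [z]
    below [x]. *)
Let below : set (I01 * (I01 * I01)) := [set p | N (point2 p.2.1 p.1 p.2.2)].

Let measurable_below : measurable below.
Proof.
rewrite -[X in measurable X]setTI.
apply: (measurable_point2 (f := fun p : I01 * (I01 * I01) => p.2.1)
  (g := fst) (h := fun p => p.2.2)) => //.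
- exact: measurableT_comp.
- exact: measurableT_comp.
Qed.

(* Locked because unfolding the product measure makes conversion of two ranks
   intractable. *)
Definition rank : I01 -> \bar R :=
  locked (fun x => (mu \x mu)%E (xsection below x)).

Let rankE x : rank x = (mu \x mu)%E (xsection below x).
Proof. by rewrite /rank -lock. Qed.

Lemma measurable_rank : measurable_fun setT rank.
Proof.
pose m2 : probability (I01 * I01)%type R := (mu \x mu)%E.
rewrite /rank -lock; exact: (measurable_fun_xsection m2 measurable_below).
Qed.

(** Vertices 0, 1, 2 carry [x], [y], [z], and transitivity is used along [z], [x], [y]. The edge
    [(x, y, a)] is fixed before [z] is chosen. *)
Lemma ae_transitive :
  \forall x \ae mu, \forall y \ae mu, \forall a \ae mu, N (point2 x y a) ->
  \forall z \ae mu, \forall b \ae mu, \forall c \ae mu,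
    N (point2 z x b) -> N (point2 z y c).
Proof.
apply: filterS (ae_triple (linN _)) => x; apply: filterS => y.
apply: filterS => a aez Nxy; apply: filterS aez => z; apply: filterS => b.
apply: filterS => c lin; apply: (@ae_const _ _ _ mu).
apply: filterS lin => d [_ _ /(_ o0 o2 o1)].
rewrite /induced_rel !pullback_pair !tripleE /= => tr Nzx.
by apply/asboolP; apply: tr; exact/asboolP.
Qed.

Lemma rank_monotone :
  \forall x \ae mu, \forall y \ae mu, \forall a \ae mu, N (point2 x y a) ->
  (rank x <= rank y)%E /\
  (rank x = rank y ->
   \forall z \ae mu, \forall b \ae mu, \forall c \ae mu,
    N (point2 z y c) -> N (point2 z x b)).
Proof.
apply: filterS ae_transitive => x; apply: filterS => y; apply: filterS => a tr Nxy.
(* Given [z], the premise depends only on [b] and the conclusion only on [c], so one of them is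
   almost surely decided. *)
have {tr Nxy}dich : \forall z \ae mu, (\forall b \ae mu, ~ N (point2 z x b)) \/
    (\forall c \ae mu, N (point2 z y c)).
  by apply: filterS (tr Nxy) => z /ae_implyP.
have mx := measurable_xsection x measurable_below.
have my := measurable_xsection y measurable_below.
(* In either case of the dichotomy the slice of this difference over [z] is null. *)
have xy0 : (mu \x mu)%E (xsection below x `\` xsection below y) = 0%E.
  apply: measure_negligible; first exact: measurableD.
  have : \forall p \ae (mu \x mu)%E, (~` (xsection below x `\` xsection below y)) p.
    apply: ae_section_product; first exact/measurableC/measurableD.
    apply: filterS dich => z [Nx|Ny].
      apply: filterS Nx => c nNx [].
      by rewrite /xsection /= inE.
    apply: filterS Ny => c Ny [_]; apply.
    by rewrite /xsection /= inE.
  by apply: negligibleS => p ABp /=; apply.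
rewrite !rankE; split; first exact: (almost_subset_le mx my xy0).
have yoo : ((mu \x mu)%E (xsection below y) < +oo)%E.
  by rewrite (le_lt_trans (probability_le1 _ my)) ?ltry.
(* Between sets of equal finite measure, inclusion up to a null set is equality up to a null set. *)
move=> /(almost_subset_eq mx my xy0 yoo) yx0.
have : \forall p \ae (mu \x mu)%E, (~` (xsection below y `\` xsection below x)) p.
  exists (xsection below y `\` xsection below x); split => //.
    exact: measurableD.
  by move=> p /= /contrapT.
move=> /ae_product_section; apply: filterS2 dich => z dich yx.
have {}yx : \forall c \ae mu, N (point2 z y c) -> N (point2 z x c).
  apply: filterS yx => c nyx Ny; apply: contrapT => nNx; apply: nyx.
  by split; rewrite /xsection /= inE.
(* If the section over [(z, x)] is null, then so is the one over [(z, y)]; if the one over [(z, y)]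
   is full, then so is the one over [(z, x)]. *)
case: dich => [Nx|Ny].
  apply: aeW => b; apply: filterS2 Nx yx => c nNx yx Ny.
  by case: (nNx (yx Ny)).
apply: filterS2 Ny yx => b Ny yx; apply: aeW => c _; exact: yx.
Qed.

Let measurable_edge (i j : 'I_3) :
  measurable [set t : espace R 'I_3 | N (pullback (pair_map i j) t)].
Proof.
rewrite -[X in measurable X]setTI.
exact: (@measurable_pullback R _ _ (pair_map i j) measurableT _ mN).
Qed.

Let measurable_rank_vertex (V : finType) (i : V) :
  measurable_fun setT (fun t : espace R V => rank (t (singleton i))).
Proof.
by apply: (measurableT_comp measurable_rank); exact: measurable_coordinate.
Qed.

(* Vertex 2 lies strictly between vertices 0 and 1 of equal rank. *)
Let middle : set (espace R 'I_3) :=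
  [set t | rank (t (singleton o0)) = rank (t (singleton o1))] `&`
  ([set t | N (pullback (pair_map o0 o1) t)] `&`
  ([set t | N (pullback (pair_map o2 o1) t)] `\`
   [set t | N (pullback (pair_map o2 o0) t)])).

Let ae_not_middle :
  \forall t \ae (lambda : probability (espace R 'I_3) R), (~` middle) t.
Proof.
apply: triple_ae.
  apply: measurableC; apply: measurableI.
    by rewrite -[X in measurable X]setTI; exact: measurable_eqe.
  by apply: measurableI => //; exact: measurableD.
apply: filterS rank_monotone => x; apply: filterS => y; apply: filterS => a mono.
have [Nxy|nNxy] := pselect (N (point2 x y a)); last first.
  (* Membership in [middle] already fails at the edge [(x, y, a)], whatever [z], [b], [c], [d]
     are. *)
  do 4! (apply: aeW => ?).
  by move=> [_ [+ _]]; rewrite /= !pullback_pair !tripleE.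
have [eqxy|neqxy] := pselect (rank x = rank y); last first.
  do 4! (apply: aeW => ?).
  by move=> [+ _]; rewrite /= !tripleE.
have [_ /(_ eqxy)] := mono Nxy.
apply: filterS => z; apply: filterS => b; apply: filterS => c NN.
apply: aeW => d [_ [_]]; rewrite /= !pullback_pair !tripleE.
by move=> [/NN Nzx nNzx]; exact: (nNzx Nzx).
Qed.

Lemma ae_rank_not_constant : \forall t \ae (lambda : probability (espace R 'I_3) R),
  ~ (rank (t (singleton o0)) = rank (t (singleton o1)) /\
     rank (t (singleton o0)) = rank (t (singleton o2))).
Proof.
(* A tuple without repetition is a relabelling of the three vertices, and there are finitely
   many. *)
have : \forall t \ae (lambda : probability (espace R 'I_3) R),
    forall s : 3.-tuple 'I_3, uniq s -> ~ middle (pullback (tnth s) t).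
  apply: filter_forall => s; case us : (uniq s); last exact: aeW.
  have s_inj : injective (tnth s) by exact/tuple_uniqP.
  by apply: filterS (ae_pullback s_inj ae_not_middle).
apply: filterS2 (linN _) => t [_ tot tr] nmid [r01 r02].
have rE i : rank (t (singleton i)) = rank (t (singleton o0)).
  case: (ord3E i) => ->; [exact: erefl|exact: (esym r01)|exact: (esym r02)].
have comp (s : 'I_3 -> 'I_3) i j :
    pullback (pair_map i j) (pullback s t) = pullback (pair_map (s i) (s j)) t.
  rewrite !pullback_pair !pullback_singleton; congr point2; congr t.
  by apply: val_inj; rewrite /= imsetU1 imset_set1.
(* Relabelling 0, 1, 2 as [i], [j], [k] would put [t] in [middle]. *)
have {}nmid i j k : induced_rel N t i k -> induced_rel N t k j -> False.
  move=> /[dup] eik /andP[ik Nik] /[dup] ekj /andP[kj Nkj].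
  have /andP[ij Nij] := tr _ _ _ eik ekj.
  have us : uniq [tuple i; j; k].
    by rewrite /= !inE negb_or ij ik eq_sym kj.
  apply: (nmid _ us).
  split; first by rewrite /= !pullback_singleton /= (rE i) (rE j).
  rewrite /= !comp; split; first exact/asboolP.
  split; first exact/asboolP.
  move=> Nki; have := tot _ _ ik; rewrite eik => /esym/negP; apply.
  by rewrite /induced_rel eq_sym ik; exact/asboolP.
(* These are the six directed paths through three vertices; each of the eight orientations of the
   three edges contains one. *)
have {nmid} := (nmid o0 o2 o1, nmid o0 o1 o2, nmid o2 o1 o0, nmid o1 o2 o0,
  nmid o1 o0 o2, nmid o2 o0 o1).
rewrite (tot o0 o1)// (tot o1 o2)// (tot o0 o2)//.
case: (induced_rel N t o1 o0); case: (induced_rel N t o2 o1);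
  case: (induced_rel N t o2 o0) => /= -[[[[[h1 h2] h3] h4] h5] h6];
  by [exact: h1|exact: h2|exact: h3|exact: h4|exact: h5|exact: h6].
Qed.

(** For fixed [x], the events that [y] and that [z] share its rank are independent copies of one
    event, so they can be jointly null only if that event is null. *)
Lemma ae_rank_neq : \forall x \ae mu, \forall y \ae mu, rank x <> rank y.
Proof.
apply: filterS (ae_triple ae_rank_not_constant) => x aex.
have {}aex : \forall y \ae mu, \forall z \ae mu,
    ~ (rank x = rank y /\ rank x = rank z).
  apply: filterS aex => y aey; apply: (@ae_const _ _ _ mu).
  apply: filterS aey => a; apply: filterS => z aez.
  do 2! (apply: (@ae_const _ _ _ mu); apply: filterS aez => ? aez).
  by apply: (@ae_const _ _ _ mu); apply: filterS aez => d; rewrite !tripleE.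
have [|neq] := pselect (\forall y \ae mu, rank x <> rank y); first by [].
(* A single [y] with the rank of [x] would already force almost every [z] to have a different
   rank. *)
apply: filterS aex => y aey xy; apply: neq; apply: filterS aey => z nxyz xz.
exact: nxyz.
Qed.

Lemma ae_rank_lt : \forall p \ae (lambda : probability (espace R 'I_2) R),
  N p -> (rank (p (singleton ord0)) < rank (p (singleton ord_max)))%E.
Proof.
pose S : set (espace R 'I_2) := ~` N `|`
  [set p | (rank (p (singleton ord0)) < rank (p (singleton ord_max)))%E].
have : \forall p \ae (lambda : probability (espace R 'I_2) R), S p.
  apply: point2_ae.
    apply: measurableU; first exact: measurableC.
    by rewrite -[X in measurable X]setTI; exact: measurable_lte.
  apply: filterS2 rank_monotone ae_rank_neq => x; apply: filterS2 => y mono neq.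
  apply: filterS mono => a mono.
  have [Nxy|] := pselect (N (point2 x y a)); last by left.
  right => /=; rewrite point2_0 point2_1 lt_neqAle.
  by have [-> _] := mono Nxy; rewrite andbT; exact/eqP.
by apply: filterS => p [//|].
Qed.

End rank.

(** * The lexicographic order as a strong limit object *)

Section lexicographic.
Context (R : realType) (f : unit_interval R -> \bar R).
Local Notation I01 := (unit_interval R).

(** Breaking ties by the coordinate itself makes this a strict linear order on all of [0, 1], with
    no exceptional null set. *)
Definition lex_lt (x y : I01) : Prop :=
  (f x < f y)%E \/ (f x = f y /\ uval x < uval y).

Definition lex_on : set (espace R 'I_2) :=
  [set p | lex_lt (p (singleton ord0)) (p (singleton ord_max))].

Lemma lex_lt_irr x : ~ lex_lt x x.
Proof. by rewrite /lex_lt !ltxx => -[|[]]. Qed.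

Lemma lex_lt_trans y x z : lex_lt x y -> lex_lt y z -> lex_lt x z.
Proof.
move=> [xy|[xy xy']] [yz|[yz yz']].
- by left; exact: lt_trans yz.
- by left; rewrite -yz.
- by left; rewrite xy.
- by right; split; [rewrite xy|exact: lt_trans yz'].
Qed.

Lemma lex_lt_total x y : x <> y -> lex_lt x y \/ lex_lt y x.
Proof.
move=> xy; rewrite /lex_lt; case: (ltgtP (f x) (f y)) => [fxy|fyx|fxy].
- by left; left.
- by right; left.
case: (ltgtP (uval x) (uval y)) => [uxy|uyx|/val_inj//].
- by left; right.
- by right; right.
Qed.

Lemma measurable_lex_on : measurable_fun setT f -> measurable lex_on.
Proof.
move=> mf.
have mfi (i : 'I_2) :
    measurable_fun setT (fun p : espace R 'I_2 => f (p (singleton i))).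
  by apply: (measurableT_comp mf); exact: measurable_coordinate.
have muval (i : 'I_2) :
    measurable_fun setT (fun p : espace R 'I_2 => uval (p (singleton i))).
  apply: (@measurableT_comp _ _ _ _ _ _ (@uval R)); last exact: measurable_coordinate.
  by move=> _ B mB; exists B.
apply: measurableU; first by rewrite -[X in measurable X]setTI; exact: measurable_lte.
apply: measurableI; first by rewrite -[X in measurable X]setTI; exact: measurable_eqe.
rewrite -[X in measurable X]setTI.
exact: (measurable_fun_ltr (muval ord0) (muval ord_max) measurableT (Y := [set true])).
Qed.

Lemma E2star_lex_on : E2star_measurable lex_on.
Proof.
move=> x y; have [xy|nxy] := pselect (lex_lt x y); [right|left].
  by apply/seteqP; split=> // z _; rewrite /lex_on /= point2_0 point2_1.
by apply/seteqP; split=> // z; rewrite /lex_on /= point2_0 point2_1.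
Qed.

(** Off the diagonal the vertices have distinct coordinates, so the induced relation is the
    restriction of [lex_lt] along an injection, hence linear. *)
Lemma strong_lex_on : measurable lex_on -> strong_linorder_on lex_on.
Proof.
move=> mlex; split.
  by exists lex_on => //; exists set0; [exact: negligible_set0|rewrite setU0].
move=> V e e_irr nlin x xe; apply: contrapT => ndiag; apply: nlin.
have inj i j : i != j -> x (singleton i) <> x (singleton j).
  by move=> ij xij; apply: ndiag; exists i, j.
have eP i j : reflect (lex_lt (x (singleton i)) (x (singleton j))) (e i j).
  have eij := induced_rel_Tind e_irr xe i j.
  rewrite eij /induced_rel; have [->|ij /=] := eqVneq i j.
    by apply: ReflectF; exact: lex_lt_irr.
  by apply: (iffP (asboolP _)); rewrite /lex_on /= !pullback_singleton.
split=> //.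
- move=> i j ij; apply/eP/idP => [lij|/eP nji].
    by apply/eP => lji; exact: (lex_lt_irr (lex_lt_trans lij lji)).
  by have [//|/nji] := lex_lt_total (inj _ _ ij).
- by move=> j i k /eP lij /eP ljk; apply/eP; exact: lex_lt_trans ljk.
Qed.

End lexicographic.

(** * Comparison of [N] with the lexicographic order, and conclusion *)

Lemma ae_lex_on (R : realType) (N : set (espace R 'I_2)) :
  measurable N ->
  (forall V : finType, \forall x \ae (lambda : probability (espace R V) R),
    strict_linear_order (induced_rel N x)) ->
  lambda.-negligible (N `+` lex_on (rank N)).
Proof.
move=> mN linN.
(* The converse inclusion applies [ae_rank_lt] to the reversed edge: where [N] fails, totality puts
   the reversed edge in [N], which reverses the strict inequality of ranks. *)
have swap_inj : injective (pair_map (ord_max : 'I_2) ord0) by exact: pair_map_inj.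
have lt := ae_rank_lt mN linN.
suff : \forall p \ae (lambda : probability (espace R 'I_2) R),
    N p <-> lex_on (rank N) p.
  apply: negligibleS => p /= [[Np nL]|[Lp nN]] [NL LN]; [exact/nL/NL|exact/nN/LN].
apply: filterS3 lt (ae_pullback swap_inj lt) (linN _) => p lt lt' [_ tot _].
split=> [/lt|Lp]; first by left.
apply: contrapT => nN.
have pE : pullback (pair_map ord0 ord_max) p = p.
  by apply: espace2_eq; rewrite pullback_pair ?point2_0 ?point2_1 ?point2_2.
have := tot ord0 ord_max isT; rewrite /induced_rel pE /=.
rewrite (asboolF nN) => /esym/negbFE /asboolP /lt'.
rewrite !pullback_singleton /= => lt10.
case: Lp => [lt01|[eq01 _]]; last by rewrite eq01 ltxx in lt10.
by have := lt_trans lt01 lt10; rewrite ltxx.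
Qed.

Theorem theorem4p14 (R : realType) (N : set (espace R 'I_2)) :
  weak_linorder_on N ->
  exists N' : set (espace R 'I_2),
    [/\ strong_linorder_on N',
        measurable N',
        E2star_measurable N' &
        lambda.-negligible (N `+` N')].
Proof.
(* [N] is the union of a Borel set [N0] and a null set [Z]; the ranks are taken with respect to
   [N0]. *)
move=> weakN; have [[N0 mN0 [Z Z0 NE]] _] := weakN.
have NN0 : lambda.-negligible (N `+` N0).
  by apply: negligibleS Z0; rewrite -NE => p [[[]//]|[? []]]; left.
have linN0 V := weak_ae_congr V weakN NN0.
have mlex := measurable_lex_on (measurable_rank mN0).
exists (lex_on (rank N0)); split.
- exact: strong_lex_on.
- exact: mlex.
- exact: E2star_lex_on.
(* Triangle inequality for symmetric differences, through [N0]. *)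
apply: negligibleS (negligibleU NN0 (ae_lex_on mN0 linN0)) => p /=.
have [N0p|nN0p] := pselect (N0 p).
  by move=> [[Np nL]|[Lp nN]]; [right; left|left; right].
by move=> [[Np nL]|[Lp nN]]; [left; left|right; right].
Qed.
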